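(* Let $M$ be a finitely generated $\mathbb Z[[x]]$-module, $x=(x_1,\dots,x_n)$, given by a presentation $$\mathbb Z[[x]]^r\xrightarrow{\,T\,}\mathbb Z[[x]]^s\to M\to0.$$ For a prime number $p$ set $$M_p:=\operatorname{coker}\big(\mathbb F_p[[x]]^r\xrightarrow{\,\bar T\,}\mathbb F_p[[x]]^s\big),\qquad M_0:=\operatorname{coker}\big(\mathbb Q[[x]]^r\xrightarrow{\,\bar T\,}\mathbb Q[[x]]^s\big),$$ where $\bar T$ is the matrix induced by $T$ by mapping coefficients to $\mathbb F_p$, resp. $\mathbb Q$. 1. Fix a prime number $p$. If $\dim_{\mathbb F_p}M_p<\infty$, then $\dim_{\mathbb F_p}M_p\ge\dim_{\mathbb Q}M_0$. Moreover, $\dim_{\mathbb F_p}M_p\ge\dim_{\mathbb F_q}M_q$ for all except finitely many prime numbers $q\in\mathbb Z$. 2. If $\dim_{\mathbb Q}M_0<\infty$, then $\dim_{\mathbb Q}M_0\ge\dim_{\mathbb F_q}M_q$ for all except finitely many prime numbers $q\in\mathbb Z$, and hence equality holds for all except finitely many prime numbers $q\in\mathbb Z$.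
   Context: $\mathbb Z[[x]]=\mathbb Z[[x_1,\dots,x_n]]$ is the formal power series ring; $\mathbb F_p=\mathbb Z/p\mathbb Z$. *)

(* Defs.v *)
From HB Require Import structures.
From mathcomp Require Import all_boot all_order all_algebra.
From mathcomp Require Import generic_quotient ring_quotient.
From mathcomp Require Import boolp.
From mathcomp Require Import mpoly.

Set Implicit Arguments.
Unset Strict Implicit.
Unset Printing Implicit Defensive.

Import GRing.Theory.
Local Open Scope ring_scope.
Local Open Scope quotient_scope.

(* R[[x_1, ..., x_n]], with coefficients indexed by the monomials 'X_{1..n};
   n = 0 is allowed and gives a copy of R. *)
Record pseries (n : nat) (R : Type) := PSeries { pcoef : 'X_{1..n} -> R }.

HB.instance Definition _ n R := gen_eqMixin (pseries n R).
HB.instance Definition _ n R := gen_choiceMixin (pseries n R).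

Lemma pseriesP n R (f g : pseries n R) :
  (forall m, pcoef f m = pcoef g m) <-> f = g.
Proof.
split=> [|-> //]; case: f g => f [g] /= fg; congr PSeries.
exact/functional_extensionality_dep.
Qed.

Section PSeriesRing.
Variables (n : nat) (R : comNzRingType).
Implicit Types (f g h : pseries n R) (m : 'X_{1..n}).

Definition ps_const (c : R) : pseries n R :=
  PSeries (fun m => if m == 0%MM then c else 0).
Definition ps_add f g := PSeries (fun m => pcoef f m + pcoef g m).
Definition ps_opp f := PSeries (fun m => - pcoef f m).

(* Cauchy product: a and b range over the finitely many monomials of degree at
   most mdeg m, which loses nothing as a + b = m forces this bound. *)
Definition ps_mul f g := PSeries (fun m =>
  \sum_(ab : 'X_{1..n < (mdeg m).+1, (mdeg m).+1} | m == (ab.1 + ab.2)%MM)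
     pcoef f ab.1 * pcoef g ab.2).

Fact ps_addA : associative ps_add.
Proof. by move=> f g h; apply/pseriesP => m /=; rewrite addrA. Qed.
Fact ps_addC : commutative ps_add.
Proof. by move=> f g; apply/pseriesP => m /=; rewrite addrC. Qed.
Fact ps_add0 : left_id (ps_const 0) ps_add.
Proof. by move=> f; apply/pseriesP => m /=; rewrite if_same add0r. Qed.
Fact ps_addN : left_inverse (ps_const 0) ps_opp ps_add.
Proof. by move=> f; apply/pseriesP => m /=; rewrite if_same addNr. Qed.

HB.instance Definition _ := GRing.isZmodule.Build (pseries n R)
  ps_addA ps_addC ps_add0 ps_addN.

Lemma pcoef0 m : pcoef (0 : pseries n R) m = 0.
Proof. by rewrite /= if_same. Qed.
Lemma pcoefD f g m : pcoef (f + g) m = pcoef f m + pcoef g m.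
Proof. by []. Qed.
Lemma pcoefN f m : pcoef (- f) m = - pcoef f m.
Proof. by []. Qed.

(* The ring laws are transferred from {mpoly R[n]} by truncation. *)
Definition ps_trunc (b : nat) f : {mpoly R[n]} :=
  \sum_(m : 'X_{1..n < b}) pcoef f m *: 'X_[m].

Lemma ps_truncE b f m : (mdeg m < b)%N -> (ps_trunc b f)@_m = pcoef f m.
Proof. exact: mcoeff_mpoly. Qed.

Lemma ps_mul_mpoly (p q : {mpoly R[n]}) f g m :
    (forall k, (mdeg k <= mdeg m)%N -> pcoef f k = p@_k) ->
    (forall k, (mdeg k <= mdeg m)%N -> pcoef g k = q@_k) ->
  pcoef (ps_mul f g) m = (p * q)@_m.
Proof.
move=> fp gq; rewrite mcoeffM /=; apply: eq_bigr => -[[a /= ha] [b /= hb]] _.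
by rewrite fp // gq.
Qed.

Fact ps_mulC : commutative ps_mul.
Proof.
move=> f g; apply/pseriesP => m; pose t := ps_trunc (mdeg m).+1.
have tE h k : (mdeg k <= mdeg m)%N -> pcoef h k = (t h)@_k.
  by move=> km; rewrite ps_truncE.
by rewrite !(ps_mul_mpoly (tE _) (tE _)) mulrC.
Qed.

Fact ps_mulA : associative ps_mul.
Proof.
move=> f g h; apply/pseriesP => m; pose t := ps_trunc (mdeg m).+1.
have tE u k : (mdeg k <= mdeg m)%N -> pcoef u k = (t u)@_k.
  by move=> km; rewrite ps_truncE.
have tME u v k : (mdeg k <= mdeg m)%N -> pcoef (ps_mul u v) k = (t u * t v)@_k.
  by move=> km; apply: ps_mul_mpoly => j /leq_trans/(_ km); apply: tE.
by rewrite (ps_mul_mpoly (tE _) (tME _ _)) (ps_mul_mpoly (tME _ _) (tE _)) mulrA.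
Qed.

Fact ps_mul1 : left_id (ps_const 1) ps_mul.
Proof.
move=> f; apply/pseriesP => m; pose t := ps_trunc (mdeg m).+1.
have tE u k : (mdeg k <= mdeg m)%N -> pcoef u k = (t u)@_k.
  by move=> km; rewrite ps_truncE.
rewrite (@ps_mul_mpoly 1 (t f)) ?mul1r; first exact/esym/tE.
- by move=> k _; rewrite mcoeff1 /=; case: eqP.
- exact: tE.
Qed.

Fact ps_mulDl : left_distributive ps_mul ps_add.
Proof.
move=> f g h; apply/pseriesP => m /=; rewrite -big_split /=.
by apply: eq_bigr => ab _; rewrite mulrDl.
Qed.

Fact ps_one_neq0 : ps_const 1 != 0.
Proof.
apply/eqP => /pseriesP/(_ 0%MM); rewrite pcoef0 /= eqxx.
exact/eqP/oner_neq0.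
Qed.

HB.instance Definition _ := GRing.Zmodule_isComNzRing.Build (pseries n R)
  ps_mulA ps_mulC ps_mul1 ps_mulDl ps_one_neq0.

Lemma pcoef1 m : pcoef (1 : pseries n R) m = (m == 0%MM)%:R.
Proof. by rewrite /=; case: eqP. Qed.

Lemma pcoefM f g m : pcoef (f * g) m =
  \sum_(ab : 'X_{1..n < (mdeg m).+1, (mdeg m).+1} | m == (ab.1 + ab.2)%MM)
     pcoef f ab.1 * pcoef g ab.2.
Proof. by []. Qed.

Fact ps_const_is_zmod_morphism : zmod_morphism ps_const.
Proof.
by move=> c d; apply/pseriesP => m; rewrite /=; case: ifP; rewrite ?subr0.
Qed.

Fact ps_const_is_monoid_morphism : monoid_morphism ps_const.
Proof.
split=> // c d; apply/pseriesP => m.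
have cE e k : (mdeg k <= mdeg m)%N -> pcoef (ps_const e) k = (e%:MP_[n])@_k.
  by rewrite mcoeffC /=; case: eqP; rewrite ?mulr1 ?mulr0.
by rewrite (ps_mul_mpoly (cE _) (cE _)) -mpolyCM -(cE _ m).
Qed.

HB.instance Definition _ :=
  GRing.isZmodMorphism.Build R (pseries n R) ps_const ps_const_is_zmod_morphism.
HB.instance Definition _ :=
  GRing.isMonoidMorphism.Build R (pseries n R) ps_const
    ps_const_is_monoid_morphism.

End PSeriesRing.

Definition ps_map (n : nat) (R S : Type) (phi : R -> S) (f : pseries n R) :
  pseries n S := PSeries (fun m => phi (pcoef f m)).

Section PSeriesMap.
Variables (n : nat) (R S : comNzRingType) (phi : {rmorphism R -> S}).

Fact ps_map_is_zmod_morphism : zmod_morphism (@ps_map n R S phi).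
Proof. by move=> f g; apply/pseriesP => m; rewrite /= rmorphB. Qed.

Fact ps_map_is_monoid_morphism : monoid_morphism (@ps_map n R S phi).
Proof.
split=> [|f g]; apply/pseriesP => m.
  by rewrite /=; case: ifP; rewrite ?rmorph1 ?rmorph0.
rewrite /= rmorph_sum; apply: eq_bigr => ab _; exact: rmorphM.
Qed.

HB.instance Definition _ := GRing.isZmodMorphism.Build
  (pseries n R) (pseries n S) (ps_map phi) ps_map_is_zmod_morphism.
HB.instance Definition _ := GRing.isMonoidMorphism.Build
  (pseries n R) (pseries n S) (ps_map phi) ps_map_is_monoid_morphism.
End PSeriesMap.

(* A matrix T : 'M[A]_(s, r) stands for the A-linear map u |-> T *m u from
   A^r = 'cV[A]_r to A^s = 'cV[A]_s. *)
Section Cokernel.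
Variables (A : comNzRingType) (s r : nat) (T : 'M[A]_(s, r)).

Definition im_mx : {pred 'cV[A]_s} :=
  fun v => `[< exists u : 'cV[A]_r, v = T *m u >].

Fact im_mx_zmod_closed : zmod_closed im_mx.
Proof.
split=> [|v w /asboolP[a ->] /asboolP[b ->]]; apply/asboolP.
  by exists 0; rewrite mulmx0.
by exists (a - b); rewrite mulmxBr.
Qed.

HB.instance Definition _ :=
  GRing.isZmodClosed.Build 'cV[A]_s im_mx im_mx_zmod_closed.

Lemma im_mxZ a v : v \in im_mx -> a *: v \in im_mx.
Proof.
by move=> /asboolP[u ->]; apply/asboolP; exists (a *: u); rewrite scalemxAr.
Qed.

Definition coker : Type := Quotient.quot im_mx.

HB.instance Definition _ := GRing.Zmodule.on coker.

Definition coker_pi (v : 'cV[A]_s) : coker := \pi_(Quotient.quot im_mx) v.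

Lemma coker_pi_eq v w : (coker_pi v = coker_pi w) <-> (v - w \in im_mx).
Proof. by rewrite Quotient.idealrBE; split=> /eqP. Qed.

Lemma coker_pi_surj (x : coker) : exists v, x = coker_pi v.
Proof. by exists (repr (x : Quotient.quot im_mx)); rewrite /coker_pi reprK. Qed.

Fact coker_pi_is_zmod_morphism : zmod_morphism coker_pi.
Proof. by move=> v w; exact: raddfB. Qed.

HB.instance Definition _ := GRing.isZmodMorphism.Build
  'cV[A]_s coker coker_pi coker_pi_is_zmod_morphism.

Definition coker_scale (a : A) (x : coker) : coker :=
  coker_pi (a *: repr (x : Quotient.quot im_mx)).

Lemma coker_pi_scale a v : coker_scale a (coker_pi v) = coker_pi (a *: v).
Proof.
apply/coker_pi_eq; rewrite -scalerBr; apply/im_mxZ/coker_pi_eq.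
by rewrite /coker_pi reprK.
Qed.

Fact coker_scaleA a b x :
  coker_scale a (coker_scale b x) = coker_scale (a * b) x.
Proof. by have [v ->] := coker_pi_surj x; rewrite !coker_pi_scale scalerA. Qed.
Fact coker_scale1 : left_id 1 coker_scale.
Proof.
by move=> x; have [v ->] := coker_pi_surj x; rewrite coker_pi_scale scale1r.
Qed.
Fact coker_scaleDr : right_distributive coker_scale +%R.
Proof.
move=> a x y; have [v ->] := coker_pi_surj x; have [w ->] := coker_pi_surj y.
by rewrite -raddfD !coker_pi_scale scalerDr raddfD.
Qed.
Fact coker_scaleDl x : {morph coker_scale^~ x : a b / a + b}.
Proof.
move=> a b; have [v ->] := coker_pi_surj x.
by rewrite !coker_pi_scale scalerDl raddfD.
Qed.

HB.instance Definition _ := GRing.Zmodule_isLmodule.Build A coker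
  coker_scaleA coker_scale1 coker_scaleDr coker_scaleDl.

Fact coker_pi_is_scalable : scalable coker_pi.
Proof. by move=> a v; rewrite -coker_pi_scale. Qed.

HB.instance Definition _ := GRing.isScalable.Build
  A 'cV[A]_s coker *:%R coker_pi coker_pi_is_scalable.

End Cokernel.

(* Restriction of scalars along phi: the underlying group of V, with
   c *: v := phi c *: v. *)
Definition restrict_scalars (k A : nzRingType) (phi : {rmorphism k -> A})
  (V : lmodType A) : Type := V.

Section RestrictScalars.
Variables (k A : nzRingType) (phi : {rmorphism k -> A}) (V : lmodType A).

HB.instance Definition _ := GRing.Zmodule.on (restrict_scalars phi V).

Definition restrict_scale (c : k) (v : restrict_scalars phi V) :
  restrict_scalars phi V := phi c *: (v : V).

Fact restrict_scaleA a b v :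
  restrict_scale a (restrict_scale b v) = restrict_scale (a * b) v.
Proof. by rewrite /restrict_scale scalerA rmorphM. Qed.
Fact restrict_scale1 : left_id 1 restrict_scale.
Proof. by move=> v; rewrite /restrict_scale rmorph1 scale1r. Qed.
Fact restrict_scaleDr : right_distributive restrict_scale +%R.
Proof. by move=> a u v; rewrite /restrict_scale scalerDr. Qed.
Fact restrict_scaleDl v : {morph restrict_scale^~ v : a b / a + b}.
Proof. by move=> a b; rewrite /restrict_scale rmorphD scalerDl. Qed.

HB.instance Definition _ :=
  GRing.Zmodule_isLmodule.Build k (restrict_scalars phi V)
    restrict_scaleA restrict_scale1 restrict_scaleDr restrict_scaleDl.
End RestrictScalars.

Section Dimension.
Variables (k : fieldType) (V : lmodType k).

Definition is_basis (d : nat) (b : 'I_d -> V) : Prop :=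
  (forall c : 'I_d -> k, \sum_i c i *: b i = 0 -> forall i, c i = 0) /\
  (forall v, exists c : 'I_d -> k, v = \sum_i c i *: b i).

Definition finite_dim : Prop := exists d (b : 'I_d -> V), is_basis b.

(* None stands for infinite dimension. *)
Definition kdim : option nat :=
  if pselect finite_dim is left fin then Some (sval (cid fin)) else None.

Lemma basis_size_le d e (b : 'I_d -> V) (b' : 'I_e -> V) :
  is_basis b -> is_basis b' -> (e <= d)%N.
Proof.
move=> [_ gen] [free' _].
pose P : 'M[k]_(e, d) := \matrix_(j, i) sval (cid (gen (b' j))) i.
have bE j : b' j = \sum_i P j i *: b i.
  rewrite {1}(svalP (cid (gen (b' j)))); apply: eq_bigr => i _.
  by rewrite mxE.
suff /eqP <- : row_free P by exact: rank_leq_col.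
apply/inj_row_free => c cP0; apply/rowP => j; rewrite mxE.
apply: (free' (fun j => c 0 j)).
under eq_bigr => l _ do rewrite bE scaler_sumr.
rewrite exchange_big big1 //= => i _.
under eq_bigr => l _ do rewrite scalerA.
by rewrite -scaler_suml; move/rowP/(_ i): cP0; rewrite !mxE => ->; rewrite scale0r.
Qed.

Lemma kdim_basis d (b : 'I_d -> V) : is_basis b -> kdim = Some d.
Proof.
move=> bb; rewrite /kdim; case: pselect => [fin|[]]; last by exists d, b.
case: cid => e [b' bb'] /=; congr Some; apply/eqP.
by rewrite eqn_leq (basis_size_le bb' bb) (basis_size_le bb bb').
Qed.

Lemma kdim_infinite : ~ finite_dim -> kdim = None.
Proof. by rewrite /kdim; case: pselect. Qed.

End Dimension.

(* The order on N u {oo}, with None as oo. *)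
Definition dim_le (d e : option nat) : bool :=
  match d, e with
  | _, None => true
  | None, Some _ => false
  | Some d, Some e => (d <= e)%N
  end.

(* The k-vector space coker (k[[x]]^r -> k[[x]]^s) of the matrix induced by T;
   this is M_p for k = 'F_p and M_0 for k = rat. *)
Definition coker_over (k : fieldType) (n s r : nat)
    (T : 'M[pseries n int]_(s, r)) : lmodType k :=
  restrict_scalars (@ps_const n k)
    (coker (map_mx (ps_map (intr : int -> k)) T)).

Definition almost_all_primes (P : nat -> Prop) : Prop :=
  exists excluded : seq nat, forall q, prime q -> q \notin excluded -> P q.

(* Main.v *)
Require Import Defs.
From HB Require Import structures.
From mathcomp Require Import all_boot all_order all_algebra.
From mathcomp Require Import boolp.
From mathcomp Require Import mpoly zify.

Set Implicit Arguments.
Unset Strict Implicit.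
Unset Printing Implicit Defensive.

Import GRing.Theory.
Local Open Scope ring_scope.

(* For a field k, let c_k(N) be the dimension of the cokernel over k modulo the
   N-th power of the ideal (x_1, ..., x_n): a number of monomials minus the rank
   of an integer matrix read in k. Hence c_Q(N) <= c_Fp(N) for every prime p,
   with equality, N being fixed, for almost all p. If c_k(N+1) <= c_k(N), then
   Nakayama's lemma shows that the N-th power of the ideal kills the cokernel,
   which then has dimension c_k(N). A bound c_k(d+1) <= d forces such an N, so
   finite dimension over k is decided by finitely many ranks of integer
   matrices. *)

(** * Ranks of integer matrices over various fields *)

(* D is a maximal nonvanishing minor over k. *)
Lemma rank_map_intr_le (m n : nat) (Z : 'M[int]_(m, n)) (k : fieldType) :
  exists D : int, D%:~R != 0 :> k /\ forall K : fieldType, D%:~R != 0 :> K ->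
    (\rank (map_mx (intr : int -> k) Z) <= \rank (map_mx (intr : int -> K) Z))%N.
Proof.
set A := map_mx _ Z; pose f := maxrankfun A.
have full : row_full (rowsub f A)^T.
  by rewrite /row_full mxrank_tr; apply: maxrowsub_free.
pose g := fullrankfun full; pose minor := rowsub g (rowsub f Z)^T.
exists (\det minor); split=> [|K].
  rewrite -det_map_mx -unitfE -unitmxE map_mxsub -map_trmx map_mxsub.
  by rewrite -row_free_unit /row_free mxrank_fullrowsub.
rewrite -det_map_mx -unitfE -unitmxE map_mxsub -map_trmx map_mxsub.
(* The minor has size the rank over [k]; being invertible over [K], it bounds the rank over [K] from
   below. *)
move/mxrank_unit => {1}<-; apply: leq_trans (mxrankS (rowsub_sub _ _)) _.
by rewrite mxrank_tr; apply/mxrankS/rowsub_sub.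
Qed.

Lemma intr_Fp_neq0 (p : nat) (D : int) : prime p ->
  (D%:~R != 0 :> 'F_p) = ~~ (p %| `|D|)%N.
Proof.
move=> pr_p; rewrite (dvdn_pcharf (pchar_Fp pr_p)).
by case: D => m; rewrite ?NegzE ?mulrNz ?oppr_eq0.
Qed.

(** An integer minor that is nonzero modulo [p] is nonzero in the rationals. *)
Lemma rank_Fp_le (m n : nat) (Z : 'M[int]_(m, n)) (p : nat) : prime p ->
  (\rank (map_mx (intr : int -> 'F_p) Z) <= \rank (map_mx (intr : int -> rat) Z))%N.
Proof.
move=> pr_p; have [D [Dp ->//]] := rank_map_intr_le Z 'F_p.
by rewrite intr_eq0; apply: contraNneq Dp => ->.
Qed.

(** The excluded primes are the divisors of one maximal nonvanishing rational minor. *)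
Lemma rank_Fp_eq (m n : nat) (Z : 'M[int]_(m, n)) :
  almost_all_primes (fun q => \rank (map_mx (intr : int -> 'F_q) Z) =
                              \rank (map_mx (intr : int -> rat) Z)).
Proof.
have [D [D0 le_rank]] := rank_map_intr_le Z rat; rewrite intr_eq0 in D0.
exists (primes `|D|) => q pr_q; rewrite mem_primes pr_q absz_gt0 D0 /= => qD.
by apply/eqP; rewrite eqn_leq rank_Fp_le // le_rank // intr_Fp_neq0.
Qed.

(** * Orders of power series *)

Section Order.
Variables (n : nat) (R : comNzRingType).
Implicit Types (f g : pseries n R) (N : nat).

Lemma submm (m : 'X_{1..n}) : (m - m = 0)%MM.
Proof. by rewrite -{1}[m]add0m addmK. Qed.

(* f lies in the N-th power of the ideal (x_1, ..., x_n). *)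
Definition vanishes N f := forall m, (mdeg m < N)%N -> pcoef f m = 0.

Lemma vanishesW N N' f : (N' <= N)%N -> vanishes N f -> vanishes N' f.
Proof. by move=> leN fN m mN; apply/fN/(leq_trans mN). Qed.

Lemma vanishesB N f g : vanishes N f -> vanishes N g -> vanishes N (f - g).
Proof. by move=> fN gN m mN; rewrite /= fN // gN // subrr. Qed.

Lemma vanishesM N N' f g : vanishes N f -> vanishes N' g -> vanishes (N + N') (f * g).
Proof.
move=> fN gN m mN; rewrite pcoefM big1 // => ab /eqP/(congr1 mdeg); rewrite mdegD => mE.
have [aN|leNa] := ltnP (mdeg ab.1) N; first by rewrite fN // mul0r.
rewrite gN ?mulr0 // -(ltn_add2l N); apply: leq_ltn_trans _ mN.
by apply: leq_trans (eq_leq (esym mE)); rewrite leq_add2r.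
Qed.

Lemma vanishesX f N : vanishes 1 f -> vanishes N (f ^+ N).
Proof. by move=> f1; elim: N => [|N IHN] //; rewrite exprS; exact: (vanishesM f1 IHN). Qed.

Lemma vanishes_inj f : (forall N, vanishes N f) -> f = 0.
Proof. by move=> fN; apply/pseriesP => m; rewrite pcoef0 (fN (mdeg m).+1). Qed.

Lemma pcoef_sum I (r : seq I) (P : pred I) (F : I -> pseries n R) m :
  pcoef (\sum_(i <- r | P i) F i) m = \sum_(i <- r | P i) pcoef (F i) m.
Proof.
by elim/big_rec2: _ => [|i x y _ <-]; rewrite ?pcoef0 ?pcoefD.
Qed.

(** The index range no longer depends on [m], so multiplication becomes a matrix product on
    truncations. *)
Lemma pcoefM_sub N f g m : (mdeg m < N)%N ->
  pcoef (f * g) m =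
  \sum_(a : 'X_{1..n < N} | (a <= m)%MM) pcoef f (m - a)%MM * pcoef g a.
Proof.
move=> mN; have tE (h : pseries n R) j : (mdeg j <= mdeg m)%N -> pcoef h j = (ps_trunc N h)@_j.
  by move=> jm; rewrite ps_truncE // (leq_ltn_trans jm).
rewrite (ps_mul_mpoly (tE _) (tE _)) (mcoeff_poly_mul_lin_rev _ _ mN).
apply: eq_bigr => a am; rewrite !ps_truncE ?bmdeg //.
exact: leq_ltn_trans (mdegB _ _) mN.
Qed.

Lemma pcoef_constM (c : R) f m : pcoef (ps_const n c * f) m = c * pcoef f m.
Proof.
rewrite (@pcoefM_sub (mdeg m).+1) // (bigD1 (BMultinom (ltnSn (mdeg m)))) /=.
  rewrite submm eqxx big1 ?addr0 // => a /andP[am ne_am].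
  rewrite (_ : _ == _ = false) ?mul0r //; apply: contraNF ne_am => /eqP sub0.
  by have := submK am; rewrite sub0 add0m => am0; apply/eqP/val_inj.
exact: lepm_refl.
Qed.

Lemma pcoefM0 f g : pcoef (f * g) 0%MM = pcoef f 0%MM * pcoef g 0%MM.
Proof.
rewrite (@pcoefM_sub 1) ?mdeg0 // (bigD1 bm0) ?lepm_refl //=.
rewrite submm big1 ?addr0 // => a /andP[_ /eqP[]].
by apply/val_inj/eqP; rewrite /= -mdeg_eq0 -leqn0 -ltnS bmdeg.
Qed.

(* g is the geometric series in 1 - f. *)
Lemma ps_unit f : pcoef f 0%MM = 1 -> exists g, f * g = 1.
Proof.
move=> f1; pose c := 1 - f; have c1 : vanishes 1 c.
  move=> m; rewrite ltnS leqn0 mdeg_eq0 => /eqP->.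
  by rewrite pcoefD pcoefN pcoef1 f1 eqxx subrr.
pose G N := \sum_(j < N) c ^+ j; pose g := PSeries (fun m => pcoef (G (mdeg m).+1) m).
(* Powers of [c] with exponent above [mdeg m] do not reach the coefficient at [m]. *)
have gG N : vanishes N (g - G N).
  move=> m mN; apply/eqP; rewrite pcoefD pcoefN subr_eq0 /= !pcoef_sum.
  rewrite -(subnKC mN) big_split_ord /= [X in _ == _ + X]big1 ?addr0 // => i _.
  by apply: (vanishesX c1); rewrite addSn ltnS leq_addr.
exists g; apply/eqP; rewrite -subr_eq0; apply/eqP/vanishes_inj => N.
have fG : f * G N = 1 - c ^+ N.
  have -> : f = - (c - 1) by rewrite /c addrAC subrr sub0r opprK.
  by rewrite mulNr -subrX1 opprB.
have -> : f * g - 1 = f * (g - G N) - c ^+ N.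
  by rewrite mulrBr fG opprB addrAC subrKA.
by apply: vanishesB (vanishesX c1); apply: (@vanishesM 0).
Qed.

End Order.

(** * Truncations of power series vectors *)

Section Truncation.
Variables (n : nat) (R : comNzRingType) (N : nat).

Local Notation width s := #|{: 'I_s * 'X_{1..n < N}}|.

Definition trunc_row s (v : 'cV[pseries n R]_s) :
    'rV[R]_(width s) :=
  \row_(l < width s) pcoef (v (enum_val l).1 0) (enum_val l).2.

Definition lift_row s (c : 'rV[R]_(width s)) :
    'cV[pseries n R]_s :=
  \col_i PSeries (fun m => if insub m is Some m' then c 0 (enum_rank (i, m')) else 0).

(* The rows are the truncations of the vectors x^a T e_j. *)
Definition trunc_mx s r (T : 'M[pseries n R]_(s, r)) :
    'M[R]_(width r, width s) :=
  \matrix_(l < width r, l' < width s)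
    let: (j, a) := enum_val l in let: (i, b) := enum_val l' in
    if (a <= b)%MM then pcoef (T i j) (b - a)%MM else 0.

Fact trunc_row_is_zmod_morphism s : zmod_morphism (@trunc_row s).
Proof. by move=> v w; apply/rowP => l; rewrite !mxE. Qed.

HB.instance Definition _ s := GRing.isZmodMorphism.Build
  'cV[pseries n R]_s 'rV[R]_(width s) (@trunc_row s) (@trunc_row_is_zmod_morphism s).

Lemma trunc_rowZ s c (v : 'cV[pseries n R]_s) :
  trunc_row (ps_const n c *: v) = c *: trunc_row v.
Proof. by apply/rowP => l; rewrite !mxE pcoef_constM. Qed.

Lemma lift_rowK s : cancel (@lift_row s) (@trunc_row s).
Proof.
by move=> c; apply/rowP => l; rewrite !mxE /= valK -surjective_pairing enum_valK.
Qed.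

Lemma trunc_row_eq0 s (v : 'cV[pseries n R]_s) :
  trunc_row v = 0 <-> forall i, vanishes N (v i 0).
Proof.
split=> [/rowP v0 i m mN|v0]; last first.
  by apply/rowP => l; rewrite !mxE v0 // bmdeg.
by have := v0 (enum_rank (i, BMultinom mN)); rewrite !mxE enum_rankK.
Qed.

(** Coefficients of [u] in degree at least [N] do not affect those of [T *m u] below [N]. The
    truncated image of [T] is thus the row space of [trunc_mx N T]. *)
Lemma trunc_rowM s r (T : 'M[pseries n R]_(s, r)) u :
  trunc_row (T *m u) = trunc_row u *m trunc_mx T.
Proof.
apply/rowP => l; rewrite !mxE pcoef_sum.
under eq_bigr => j _ do rewrite (pcoefM_sub _ _ (bmdeg _)) big_mkcond /=.
rewrite pair_bigA /= [RHS](reindex _ (onW_bij _ (enum_rank_bij _))) /=.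
apply: eq_bigr => -[j a] _; rewrite !mxE !enum_rankK /=.
by case: (enum_val l) => i b /=; case: ifP; rewrite ?mulr0 // mulrC.
Qed.

End Truncation.

Lemma map_trunc_mx (n N s r : nat) (T : 'M[pseries n int]_(s, r)) (k : fieldType) :
  trunc_mx N (map_mx (ps_map (intr : int -> k)) T) =
  map_mx (intr : int -> k) (trunc_mx N T).
Proof.
apply/matrixP => l l'; rewrite !mxE; case: (enum_val l) => j a.
by case: (enum_val l') => i b; case: ifP; rewrite // mxE.
Qed.

(** * Dimension of the cokernel and of its truncations *)

Section CokerDimension.
Variables (n : nat) (k : fieldType) (s r : nat) (T : 'M[pseries n k]_(s, r)).
Let V := restrict_scalars (@ps_const n k) (coker T).

Lemma submx_truncP N (v : 'cV[pseries n k]_s) :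
  (trunc_row N v <= trunc_mx N T)%MS <->
  exists u, forall i, vanishes N ((v - T *m u) i 0).
Proof.
split=> [/submxP[c vE]|[u /trunc_row_eq0]].
  exists (lift_row c); apply/trunc_row_eq0.
  by rewrite raddfB /= trunc_rowM lift_rowK vE subrr.
by rewrite raddfB /= => /eqP; rewrite subr_eq0 trunc_rowM => /eqP->; apply: submxMl.
Qed.

Lemma coker_pi_comb d (c : 'I_d -> k) (v : 'I_d -> 'cV[pseries n k]_s) :
  \sum_i c i *: (coker_pi T (v i) : V) =
  coker_pi T (\sum_i ps_const n (c i) *: v i).
Proof. by rewrite raddf_sum; apply: eq_bigr => i _; rewrite [RHS]linearZ. Qed.

(* The dimension of the cokernel modulo the N-th power of (x_1, ..., x_n). *)
Definition codim N : nat :=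
  (#|{: 'I_s * 'X_{1..n < N}}| - \rank (trunc_mx N T))%N.

(** Truncated representatives of a spanning family, together with the truncated image of [T], span
    all truncated vectors; the bound compares ranks. *)
Lemma codim_le_basis N d (b : 'I_d -> V) : is_basis b -> (codim N <= d)%N.
Proof.
move=> [_ gen]; pose v l := sval (cid (coker_pi_surj (b l : coker T))).
have bE l : b l = coker_pi T (v l) by rewrite /v; case: cid.
pose W := \matrix_l trunc_row N (v l).
have full : row_full (trunc_mx N T + W)%MS.
  rewrite -sub1mx; apply/row_subP => l; move: (row l _) => w.
  rewrite -(lift_rowK w); have [c] := gen (coker_pi T (lift_row w) : V).
  under eq_bigr do rewrite bE.
  rewrite coker_pi_comb => /coker_pi_eq/asboolP[u /eqP]; rewrite subr_eq => /eqP->.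
  rewrite raddfD /= trunc_rowM addmx_sub_adds ?submxMl //.
  rewrite raddf_sum summx_sub //= => i _; rewrite trunc_rowZ scalemx_sub //.
  by rewrite -(rowK (fun l => trunc_row N (v l))) row_sub.
rewrite leq_subLR; apply: leq_trans (eq_leq (esym (eqP full))) _.
apply: leq_trans (mxrank_adds_leqif _ _) _.
by rewrite leq_add2l rank_leq_row.
Qed.

(* A complement of the image of T, lifted to polynomial vectors, is a basis. *)
Lemma kdim_codim N :
  (forall v : 'cV_s, (forall i, vanishes N (v i 0)) -> v \in im_mx T) ->
  kdim V = Some (codim N).
Proof.
move=> smallT; pose Q := trunc_mx N T; rewrite /codim -mxrank_compl.
pose W := row_base Q^C%MS; pose v l : 'cV_s := lift_row (row l W).
have vE (c : 'I_(\rank Q^C) -> k) :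
    trunc_row N (\sum_l ps_const n (c l) *: v l) = (\row_l c l) *m W.
  rewrite raddf_sum mulmx_sum_row; apply: eq_bigr => l _.
  by rewrite /= trunc_rowZ lift_rowK mxE.
apply: (@kdim_basis _ _ _ (fun l => coker_pi T (v l) : V)); split=> [c|x].
  rewrite coker_pi_comb => c0 l.
  have /asboolP[u cE] : \sum_l ps_const n (c l) *: v l \in im_mx T.
    by rewrite -[X in X \in _]subr0; apply/coker_pi_eq; rewrite c0 raddf0.
  (* This truncation lies both in [Q] and in its complement. *)
  have cW0 : (\row_l c l) *m W = 0.
    apply/eqP; rewrite -submx0 -(capmx_compl Q) sub_capmx.
    rewrite -{1}vE cE trunc_rowM submxMl /=.
    by apply: submx_trans (submxMl _ _) _; rewrite eq_row_base.
  have /rowP/(_ l) := row_free_inj (row_base_free _) (etrans cW0 (esym (mul0mx _ W))).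
  by rewrite !mxE.
have [w ->] := coker_pi_surj (x : coker T).
have : (trunc_row N w <= Q + Q^C)%MS by rewrite submx_full // addsmx_compl_full.
case/sub_addsmxP => -[c1 c2] /= wE.
have /submxP[c cE] : (c2 *m Q^C <= W)%MS by rewrite eq_row_base submxMl.
exists (fun l => c 0 l); rewrite coker_pi_comb; apply/coker_pi_eq.
have rE : \row_l c 0 l = c by apply/rowP => l; rewrite mxE.
(* After [T *m lift_row c1] is removed as well, the remainder vanishes below degree [N], so [smallT]
   applies. *)
rewrite -[X in X \in _](subrK (T *m lift_row c1)) rpredD //; last first.
  by apply/asboolP; exists (lift_row c1).
apply/smallT/trunc_row_eq0.
by rewrite !raddfB /= vE rE trunc_rowM lift_rowK wE cE addrK subrr.
Qed.

End CokerDimension.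

(** * Nakayama's lemma for power series *)

Section Nakayama.
Variables (n : nat) (R : comNzRingType).
Implicit Types (f : pseries n R) (m : 'X_{1..n}) (N : nat).

Definition ps_monomial m : pseries n R := PSeries (fun b => (b == m)%:R).

Lemma lepm_mdeg m m' : (m <= m')%MM -> (mdeg m <= mdeg m')%N.
Proof. by move/submK <-; rewrite mdegD leq_addl. Qed.

Lemma pcoef_monomialM m f b :
  pcoef (ps_monomial m * f) b = if (m <= b)%MM then pcoef f (b - m)%MM else 0.
Proof.
rewrite mulrC (@pcoefM_sub _ _ (mdeg b).+1) //; case: ifP => mb.
  have mN : (mdeg m < (mdeg b).+1)%N by rewrite ltnS lepm_mdeg.
  rewrite (bigD1 (BMultinom mN)) //= eqxx mulr1 big1 ?addr0 // => a /andP[_ am].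
  rewrite (_ : _ == _ = false) ?mulr0 //; apply: contraNF am => /eqP am.
  by apply/eqP/val_inj.
rewrite big1 // => a ab /=; rewrite (_ : _ == _ = false) ?mulr0 //.
by apply: contraFF mb => /eqP <-.
Qed.

Lemma submonomial N m : (N <= mdeg m)%N -> exists2 m', (m' <= m)%MM & mdeg m' = N.
Proof.
elim: N => [|N IHN] Nm.
  by exists 0%MM; rewrite ?mdeg0 //; apply/mnm_lepP => i; rewrite mnm0E.
have [m' m'm m'N] := IHN (ltnW Nm).
have [i mi] : exists i, (m - m')%MM i != 0%N.
  apply/existsP; apply: contraLR Nm => /existsPn mm'.
  rewrite -leqNgt -m'N -{1}(submK m'm) mdegD.
  suff -> : (m - m')%MM = 0%MM by rewrite mdeg0.
  by apply/mnmP => i; rewrite mnm0E; apply/eqP/negbNE.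
exists (U_(i) + m')%MM; last by rewrite mdegD mdeg1 m'N.
rewrite -(submK m'm); apply/mnm_lepP => j; rewrite !mnmDE leq_add2r.
by apply/mnm_lepP; rewrite lep1mP.
Qed.

(** Dividing each monomial of [f] by a chosen divisor of degree [N] gives the [w m]. If [f] has no
    term of degree [N], no quotient is constant, whence the second clause. *)
Lemma vanishes_decomp N f : vanishes N f ->
  exists w : 'X_{1..n < N.+1} -> pseries n R,
    f = \sum_(m : 'X_{1..n < N.+1} | mdeg m == N) ps_monomial m * w m /\
    (vanishes N.+1 f -> forall m : 'X_{1..n < N.+1}, mdeg m = N -> vanishes 1 (w m)).
Proof.
move=> fN; pose P b (m : 'X_{1..n < N.+1}) := (mdeg m == N) && (m <= b)%MM.
(* Each monomial b of f is attributed to a single divisor ch b of degree N. *)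
pose ch b := [pick m | P b m].
pose w (m : 'X_{1..n < N.+1}) :=
  PSeries (fun a => if ch (a + m)%MM == Some m then pcoef f (a + m)%MM else 0).
exists w; split=> [|fN1 m mN a]; last first.
  rewrite ltnS leqn0 mdeg_eq0 => /eqP -> /=; case: ifP => // _.
  by rewrite fN1 // add0m mN.
apply/pseriesP => b; rewrite pcoef_sum.
under eq_bigr => m _ do rewrite pcoef_monomialM.
rewrite -big_mkcondr /=.
have wE (m : 'X_{1..n < N.+1}) : P b m ->
    pcoef (w m) (b - m)%MM = if ch b == Some m then pcoef f b else 0.
  by case/andP=> _ mb /=; rewrite submK.
rewrite (eq_bigr _ wE) -big_mkcondr /=; rewrite /ch; case: pickP => [m Pm|noP].
  rewrite (big_pred1 m) // => m'; apply/andP/eqP => [[_ /eqP[->]] //|->].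
  by rewrite eqxx.
rewrite big_pred0 => [|m]; last by rewrite andbF.
apply: fN; rewrite ltnNge; apply/negP => /submonomial[m mb mN].
have mN1 : (mdeg m < N.+1)%N by rewrite mN.
by have := noP (BMultinom mN1); rewrite /P /= mN eqxx mb.
Qed.

(** The hypothesis gives [G = T *m U + G *m C], where the columns of [G] generate the vectors of
    order [N] and [C] has no constant terms. Then [1%:M - C] is invertible. *)
Lemma nakayama N s r (T : 'M[pseries n R]_(s, r)) :
  (forall v : 'cV_s, (forall i, vanishes N (v i 0)) ->
     exists u, forall i, vanishes N.+1 ((v - T *m u) i 0)) ->
  forall v : 'cV_s, (forall i, vanishes N (v i 0)) -> v \in im_mx T.
Proof.
move=> step.
(* The columns are the monomials of degree exactly [N] times unit vectors; those indexed by smaller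
   degrees are zero. *)
pose G : 'M[pseries n R]_(s, #|{: 'I_s * 'X_{1..n < N.+1}}|) :=
  \matrix_(i < s, l < #|{: 'I_s * 'X_{1..n < N.+1}}|)
    if (i == (enum_val l).1) && (mdeg (enum_val l).2 == N)
    then ps_monomial (enum_val l).2 else 0.
have GP (v : 'cV_s) : (forall i, vanishes N (v i 0)) -> exists w, v = G *m w /\
    ((forall i, vanishes N.+1 (v i 0)) -> forall l, vanishes 1 (w l 0)).
  move=> vN; have /choice[w wP] i := vanishes_decomp (vN i).
  exists (\col_(l < #|{: 'I_s * 'X_{1..n < N.+1}}|)
    if mdeg (enum_val l).2 == N then w (enum_val l).1 (enum_val l).2 else 0).
  split=> [|vN1 l]; last first.
    rewrite mxE; case: eqP => [mN|_ m _]; last exact: pcoef0.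
    exact: (proj2 (wP _) (vN1 _)).
  apply/colP => i; rewrite mxE (reindex _ (onW_bij _ (enum_rank_bij _))) /=.
  rewrite [LHS](proj1 (wP i)) big_mkcond /=.
  transitivity (\sum_(j < s) \sum_(m : 'X_{1..n < N.+1})
    if i == j then if mdeg m == N then ps_monomial m * w i m else 0 else 0).
    rewrite (bigD1 i) //= eqxx [X in _ + X]big1 ?addr0 // => j ji.
    by rewrite big1 // => m _; rewrite eq_sym (negPf ji).
  rewrite pair_bigA; apply: eq_bigr => -[j m] _; rewrite !mxE !enum_rankK /=.
  by case: eqP => [->|_]; case: ifP; rewrite ?mul0r.
have GN l i : vanishes N (col l G i 0).
  move=> m mN; rewrite !mxE; case: ifP => [/andP[_ /eqP lN]|_]; last exact: pcoef0.
  by rewrite /=; case: eqP mN => // ->; rewrite lN ltnn.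
have /choice[uw uwP] l : exists uw,
    col l G = T *m uw.1 + G *m uw.2 /\ forall j, vanishes 1 (uw.2 j 0).
  have [u uP] := step _ (GN l).
  have [w [wE w1]] := GP _ (fun i => vanishesW (leqnSn N) (uP i)).
  by exists (u, w); split; [rewrite /= -wE addrC subrK | apply: w1].
pose U := \matrix_(j, l) (uw l).1 j 0; pose C := \matrix_(j, l) (uw l).2 j 0.
have GE : G = T *m U + G *m C.
  apply/matrixP => i l; have [/colP/(_ i)] := uwP l; rewrite !mxE => -> _.
  by congr (_ + _); apply: eq_bigr => j _; rewrite !mxE.
have GT : G *m (1%:M - C) = T *m U by rewrite mulmxBr mulmx1 {1}GE addrK.
have [h hE] : exists h, \det (1%:M - C) * h = 1.
  (* Taking constant coefficients is a ring morphism that sends [1%:M - C] to the identity, so the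
     determinant has constant term 1. *)
  apply: ps_unit; pose ev := fun f : pseries n R => pcoef f 0%MM.
  have evB : zmod_morphism ev by [].
  have evM : monoid_morphism ev.
    by split=> [|f g]; [rewrite /ev pcoef1 eqxx | exact: pcoefM0].
  pose evZ := GRing.isZmodMorphism.Build _ _ ev evB.
  pose evR := GRing.isMonoidMorphism.Build _ _ ev evM.
  pose phi : {rmorphism pseries n R -> R} := HB.pack ev evZ evR.
  rewrite -[LHS](det_map_mx phi) (_ : map_mx _ _ = 1%:M) ?det1 //.
  rewrite map_mxB map_mx1 (_ : map_mx phi C = 0) ?subr0 //.
  apply/matrixP => j l; rewrite !mxE; by apply: (proj2 (uwP l)); rewrite mdeg0.
move=> v /GP[w [-> _]]; apply/asboolP.
(* Here [h *: \adj (1%:M - C)] is the inverse of [1%:M - C]. *)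
exists (U *m (h *: (\adj (1%:M - C) *m w))).
rewrite mulmxA -GT -mulmxA -scalemxAr (mulmxA _ (\adj _)) mul_mx_adj.
by rewrite mul_scalar_mx scalerA mulrC hE scale1r.
Qed.

End Nakayama.

(** * Stabilisation of the truncated dimensions *)

Section Stabilisation.
Variables (n : nat) (k : fieldType) (s r : nat) (T : 'M[pseries n k]_(s, r)).

Lemma kdim_stable N : (codim T N.+1 <= codim T N)%N ->
  kdim (restrict_scalars (@ps_const n k) (coker T)) = Some (codim T N).
Proof.
move=> le_codim; apply/kdim_codim/nakayama => v vN; apply/submx_truncP.
set Q' := trunc_mx N.+1 T; set Q := trunc_mx N T in le_codim *.
pose g (l : 'I_#|{: 'I_s * 'X_{1..n < N}}|) : 'I_#|{: 'I_s * 'X_{1..n < N.+1}}| :=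
  enum_rank ((enum_val l).1,
    BMultinom (leq_trans (bmdeg (enum_val l).2) (leqnSn N))).
(* [P] forgets the coefficients of degree [N]. *)
pose P := colsub g (1%:M : 'M[k]__).
have PE (w : 'cV_s) : trunc_row N.+1 w *m P = trunc_row N w.
  by rewrite mulmx_colsub mulmx1; apply/rowP => l; rewrite !mxE enum_rankK.
have Pfull : row_full P.
  rewrite -sub1mx; apply/row_subP => l.
  by rewrite -(lift_rowK (row l _)) -PE submxMl.
have QP : (Q' *m P <= Q)%MS.
  apply/row_subP => l; rewrite row_mul rowE -(lift_rowK (delta_mx _ _)).
  by rewrite -trunc_rowM PE trunc_rowM submxMl.
(* Rank count: if the codimension does not grow, [Q'] meets [kermx P] in the full dimension of
   [kermx P]. So every vector of order [N] is in the image of [T] up to order [N.+1], as [nakayama]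
   requires. *)
have kerP : (kermx P <= Q')%MS.
  apply: submx_trans (capmxSl _ (kermx P)).
  rewrite -(geq_leqif (mxrank_leqif_sup (capmxSr Q' (kermx P)))) mxrank_ker.
  rewrite (eqP Pfull).
  have arith C C' x y z : (z <= C -> x <= z -> C' - (x + y) <= C - z ->
    C' - C <= y)%N by lia.
  apply: (arith _ _ _ _ _ (rank_leq_col Q) (mxrankS QP)).
  by rewrite mxrank_mul_ker.
by apply: submx_trans kerP; apply/sub_kermxP; rewrite PE; apply/trunc_row_eq0.
Qed.

(** Strict growth at each [N <= d] would force [codim T d.+1] above [d]. *)
Lemma kdim_bounded d : (codim T d.+1 <= d)%N ->
  exists2 N, (codim T N.+1 <= codim T N)%N &
    kdim (restrict_scalars (@ps_const n k) (coker T)) = Some (codim T N).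
Proof.
move=> le_d; have /existsP[N stable] :
    [exists N : 'I_d.+1, (codim T N.+1 <= codim T N)%N].
  apply: contraLR le_d => /existsPn grows; rewrite -ltnNge.
  suff: forall N, (N <= d.+1)%N -> (N <= codim T N)%N by apply.
  elim=> // N IHN Nd; have := grows (Ordinal Nd); rewrite -ltnNge.
  by apply: leq_ltn_trans; apply/IHN/ltnW.
by exists N; last apply: kdim_stable.
Qed.

End Stabilisation.

(** * Comparison of the dimensions over the prime fields *)

Theorem corollary25 (n r s : nat) (T : 'M[pseries n int]_(s, r))
    (M : lmodType (pseries n int))
    (pi : {linear 'cV[pseries n int]_s -> M})
    (pi_surj : forall x : M, exists v, pi v = x)
    (pi_exact : forall v, pi v = 0 <-> exists u : 'cV_r, v = T *m u) :
  let M_ (p : nat) := coker_over 'F_p T in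
  let M0 := coker_over rat T in
  (forall p : nat, prime p -> finite_dim (M_ p) ->
     dim_le (kdim M0) (kdim (M_ p)) /\
     almost_all_primes (fun q => dim_le (kdim (M_ q)) (kdim (M_ p)))) /\
  (finite_dim M0 ->
     almost_all_primes (fun q => dim_le (kdim (M_ q)) (kdim M0)) /\
     almost_all_primes (fun q => kdim (M_ q) = kdim M0)).
Proof.
move=> M_ M0.
pose c (k : fieldType) := codim (map_mx (ps_map (intr : int -> k)) T).
have c_Fp p N : prime p -> (c rat N <= c 'F_p N)%N.
  by move=> pr_p; rewrite /c /codim !map_trunc_mx leq_sub2l // rank_Fp_le.
have c_eq N : almost_all_primes (fun q => c 'F_q N = c rat N).
  have [l lP] := rank_Fp_eq (trunc_mx N T); exists l => q pr_q ql.
  by rewrite /c /codim !map_trunc_mx lP.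
have part2 : finite_dim M0 -> almost_all_primes (fun q => kdim (M_ q) = kdim M0).
  move=> [d [b bP]].
  have [N stable dimM0] := kdim_bounded (codim_le_basis d.+1 bP).
  (* Stability involves only the levels [N] and [N.+1], so it passes to almost all [q]. *)
  have [l lP] := c_eq N; have [l' l'P] := c_eq N.+1.
  exists (l ++ l') => q pr_q; rewrite mem_cat negb_or => /andP[ql ql'].
  rewrite [RHS]dimM0 -/(c rat N) -(lP q pr_q ql); apply: kdim_stable.
  by rewrite -/(c 'F_q N) -/(c 'F_q N.+1) lP // l'P.
split=> [p pr_p [d [b bP]]|finM0]; last first.
  have [l lP] := part2 finM0; split; exists l => // q pr_q ql.
  by rewrite lP //; case: (kdim M0) => [e|] /=.
(* The bound over ['F_p] at level [d.+1] descends to [rat], which makes [M0] finite-dimensional. *)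
have le_d := leq_trans (c_Fp p d.+1 pr_p) (codim_le_basis d.+1 bP).
have [N stable dimM0] := kdim_bounded le_d.
have le_dim : dim_le (kdim M0) (kdim (M_ p)).
  rewrite (kdim_basis bP) [kdim M0]dimM0 /=.
  exact: leq_trans (c_Fp p N pr_p) (codim_le_basis N bP).
split=> //.
have finM0 : finite_dim M0.
  apply: contrapT => infM0; have := kdim_infinite infM0.
  by rewrite [kdim M0]dimM0.
have [l lP] := part2 finM0.
by exists l => q pr_q ql; rewrite lP.
Qed.
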